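(* Let $G=(V,\mathcal{A})$ be a hypergraph (with $|V|=n$) and let $f^G:\{0,1\}^n\to\mathbb{R}_{\geq 0}$ admit a log-supermodular factorization over $G$, i.e. $f^G(x)=\prod_{i\in V}\phi_i(x_i)\prod_{\alpha\in\mathcal{A}}\psi_\alpha(x_\alpha)$ with nonnegative potentials $\phi_i$ and with every $\psi_\alpha$ log-supermodular. Then for every $k\geq 1$ and every $k$-cover $H$ of (the factor graph of) $G$, \[Z(H)\leq Z(G)^k.\]
   Context: A function $\psi:\{0,1\}^m\to\mathbb{R}_{\geq 0}$ is log-supermodular if $\psi(x)\psi(y)\leq\psi(x\wedge y)\psi(x\vee y)$ for all $x,y$, with $\wedge,\vee$ the componentwise min and max. A function $f:\{0,1\}^n\to\mathbb{R}_{\geq0}$ factors over a hypergraph $G=(V,\mathcal{A})$, $\mathcal{A}\subseteq 2^V$, if $f(x)=\prod_{i\in V}\phi_i(x_i)\prod_{\alpha\in\mathcal{A}}\psi_\alpha(x_\alpha)$ for some $\phi_i:\{0,1\}\to\mathbb{R}_{\geq 0}$ and $\psi_\alpha:\{0,1\}^{|\alpha|}\to\mathbb{R}_{\geq0}$, where $x_\alpha$ is the subvector of $x$ indexed by $\alpha$; the factorization is log-supermodular if every $\psi_\alpha$ is log-supermodular. The factor graph of $G$ is the bipartite graph with a variable node for each $i\in V$, a factor node for each $\alpha\in\mathcal{A}$, and an edge between $\alpha$ and $i$ iff $i\in\alpha$. A graph $H$ covers a graph $G$ if there is a graph homomorphism $h:H\to G$ such that for every vertex $v$ of $G$ and every $w\in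 h^{-1}(v)$, $h$ maps the neighborhood of $w$ bijectively onto the neighborhood of $v$; $H$ is a $k$-cover if every vertex of $G$ has exactly $k$ preimages. Thus a $k$-cover of the factor graph has $k$ copies of each variable node and each factor node, each copy of $\alpha$ being joined to exactly one copy of each $i\in\alpha$. To a $k$-cover $H$ one associates the function $f^H:\{0,1\}^{kn}\to\mathbb{R}_{\geq0}$ that is the product, over variable nodes $w$ of $H$, of $\phi_{h(w)}(x_w)$ and, over factor nodes $\beta$ of $H$, of $\psi_{h(\beta)}$ evaluated at the variables adjacent to $\beta$ (ordered via $h$). The partition functions are $Z(G)=\sum_{x\in\{0,1\}^n}f^G(x)$ and $Z(H)=\sum_{y\in\{0,1\}^{kn}}f^H(y)$. *)

(* Defs.v *)
From HB Require Import structures.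
From mathcomp Require Import all_boot all_order all_algebra.
From mathcomp Require Import reals.

Set Implicit Arguments.
Unset Strict Implicit.
Unset Printing Implicit Defensive.

Import Order.TTheory GRing.Theory Num.Theory.

Local Open Scope ring_scope.

Record graph := Graph {
  vertex :> finType;
  adj : rel vertex;
  adj_sym : symmetric adj;
  adj_irrefl : irreflexive adj }.

Definition nbhd (G : graph) (v : G) : {set G} := [set w | adj v w].

Record covering (H G : graph) (h : H -> G) : Prop := Covering {
  covering_hom : {homo h : u w / adj u w};
  covering_inj : forall w : H, {in nbhd w &, injective h};
  covering_onto : forall w : H, h @: nbhd w = nbhd (h w) }.

Definition kcover (k : nat) (H G : graph) (h : H -> G) : Prop :=
  covering h /\ forall v : G, #|[set w | h w == v]| = k.

Section FactorGraph.
Variables (V : finType) (A : {set {set V}}).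

Definition fg_node : finType := (V + {alpha : {set V} | alpha \in A})%type.

Definition fg_adj (u v : fg_node) : bool :=
  match u, v with
  | inl i, inr alpha | inr alpha, inl i => i \in val alpha
  | _, _ => false
  end.

Lemma fg_adj_sym : symmetric fg_adj.
Proof. by case=> [i|a] [j|b]. Qed.

Lemma fg_adj_irrefl : irreflexive fg_adj.
Proof. by case. Qed.

Definition factor_graph : graph := Graph fg_adj_sym fg_adj_irrefl.

Definition is_var (u : factor_graph) : bool := if u is inl _ then true else false.

End FactorGraph.

(* 0/1 vectors indexed by I: the booleans false and true stand for 0 and 1,
   so that componentwise min and max are && and ||. *)
Notation config I := {ffun I -> bool}.

Definition cmeet (I : finType) (x y : config I) : config I :=
  [ffun i => x i && y i].

Definition cjoin (I : finType) (x y : config I) : config I :=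
  [ffun i => x i || y i].

Definition subconfig (V : finType) (alpha : {set V}) (x : config V) :
  config {i : V | i \in alpha} := [ffun i => x (val i)].

Section Potentials.
Variable R : realType.

Definition log_supermodular (I : finType) (psi : config I -> R) : Prop :=
  forall x y, psi x * psi y <= psi (cmeet x y) * psi (cjoin x y).

Definition partition_function (I : finType) (f : config I -> R) : R :=
  \sum_(x : config I) f x.

Variables (V : finType) (A : {set {set V}}).

(* The family psi is indexed by all subsets of V, but only its members psi alpha
   with alpha in A are ever constrained or used. *)
Variables (phi : V -> bool -> R)
  (psi : forall alpha : {set V}, config {i : V | i \in alpha} -> R).

Record factorization (f : config V -> R) : Prop := Factorization {
  phi_ge0 : forall i b, 0 <= phi i b;
  psi_ge0 : forall alpha, alpha \in A -> forall x, 0 <= psi (alpha := alpha) x;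
  factorizationE : forall x,
    f x = (\prod_(i : V) phi i (x i)) *
          (\prod_(alpha in A) psi (subconfig alpha x)) }.

Definition log_supermodular_factorization (f : config V -> R) : Prop :=
  factorization f /\
  forall alpha, alpha \in A -> log_supermodular (psi (alpha := alpha)).

Section CoverFunction.
Variables (H : graph) (h : H -> factor_graph A).

Definition var_node : finType := {w : H | is_var (h w)}.

Definition copy_at (beta : H) (i : V) : option var_node :=
  [pick w : var_node | adj beta (val w) && (h (val w) == inl i)].

(* The values of y at the neighbours of a factor node beta above alpha, indexed
   by alpha via h. When h is a covering, the neighbour above each i in alpha
   exists and is unique (copy_atP, copy_at_uniq), so the default value false
   is never used. *)
Definition local_config (y : config var_node) (beta : H) (alpha : {set V}) :
  config {i : V | i \in alpha} :=
  [ffun i => if copy_at beta (val i) is Some w then y w else false].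

(* The products over all variable nodes and over all factor nodes of H, with the
   nodes grouped by their image under h. *)
Definition cover_function (y : config var_node) : R :=
  (\prod_(i : V) \prod_(w : var_node | h (val w) == inl i) phi i (y w)) *
  (\prod_(alpha : {alpha : {set V} | alpha \in A})
     \prod_(beta : H | h beta == inr alpha)
       psi (local_config y beta (val alpha))).

Lemma copy_atP (beta : H) (alpha : {alpha : {set V} | alpha \in A}) (i : V) :
  covering h -> h beta = inr alpha -> i \in val alpha ->
  exists w : var_node,
    [/\ copy_at beta i = Some w, adj beta (val w) & h (val w) = inl i].
Proof.
move=> [_ _ onto] hb ia; rewrite /copy_at.
case: pickP => [w /andP[bw /eqP hw]|none]; first by exists w.
have: (inl i : factor_graph A) \in nbhd (h beta) by rewrite hb inE.
rewrite -onto => /imsetP[w]; rewrite inE => bw hw.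
have vw : is_var (h w) by rewrite -hw.
by have := none (exist _ w vw); rewrite /= bw -hw eqxx.
Qed.

Lemma copy_at_uniq (beta : H) (i : V) (w w' : var_node) :
  covering h -> adj beta (val w) -> adj beta (val w') ->
  h (val w) = inl i -> h (val w') = inl i -> w = w'.
Proof.
move=> [_ inj _] bw bw' hw hw'; apply/val_inj.
by apply: (inj beta); rewrite ?inE ?hw ?hw'.
Qed.

End CoverFunction.
End Potentials.

(* Main.v *)
Require Import Defs.
From HB Require Import structures.
From mathcomp Require Import all_boot all_order all_algebra.
From mathcomp Require Import reals exp.
From mathcomp Require Import ring lra zify.

Set Implicit Arguments.
Unset Strict Implicit.
Unset Printing Implicit Defensive.

Import Order.TTheory GRing.Theory Num.Theory.
Local Open Scope ring_scope.

(* Write z_j(y), j < k, for the configuration on V whose value at i is 1 iff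
   more than j of the k copies of i carry the value 1 in y. Sorting the values
   by successive meets and joins in every log-supermodular factor gives
   f^H(y) <= prod_j f^G(z_j(y)), and f^H is itself log-supermodular. These two
   properties alone imply Z(H) <= Z(G)^k: sum out the k copies of one vertex of
   V at a time, log-supermodularity being preserved by the four functions
   theorem. The step for one vertex is the inequality sum F <= prod_j (q_j + p_j)
   for a log-supermodular F on {0,1}^k with
   F(t) <= p_0 ... p_(m-1) q_m ... q_(k-1) whenever t has m ones. Order the
   coordinates by decreasing marginals of the distribution proportional to F;
   supermodularity of ln F along the chain of initial segments, Abel summation
   and Gibbs' inequality ln u <= u - 1 then bound sum F by the total mass of the
   product measure with weights q_j, p_j. *)

(** * Products of log-supermodular functions, and order statistics *)

Lemma log_supermodular_prod (R : realType) (I : finType) (J : Type)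
    (r : seq J) (P : pred J) (F : J -> config I -> R) :
  (forall j, P j -> forall x, 0 <= F j x) ->
  (forall j, P j -> log_supermodular (F j)) ->
  log_supermodular (fun x => \prod_(j <- r | P j) F j x).
Proof.
move=> F0 Flsm x y; rewrite -!big_split; apply: ler_prod => j Pj /=.
by rewrite mulr_ge0 ?F0 //= Flsm.
Qed.

(** Every coordinate is sorted in decreasing order on its own: for nonempty [X], index 0 is the join
    of the list and the last index its meet. *)
Definition order_stat (I : finType) (X : seq (config I)) (j : nat) : config I :=
  [ffun i => j < count (fun x : config I => x i) X]%N.

(** Insertion sort: [x] travels along the sorted chain, and at each member the pair is replaced by
    its join, which stays, and its meet, which travels on. *)
Lemma prod_le_order_stat (R : realType) (I : finType) (psi : config I -> R)
    (X : seq (config I)) :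
  (forall x, 0 <= psi x) -> log_supermodular psi ->
  \prod_(x <- X) psi x <= \prod_(j < size X) psi (order_stat X j).
Proof.
move=> psi0 psi_lsm; elim: X => [|x X IH]; first by rewrite big_nil big_ord0.
(* What is left of [x] after it has passed the first [m] members. *)
pose carry m : config I := [ffun i => x i && (m <= count (fun y : config I => y i) X)%N].
have step m : psi x * \prod_(j < m) psi (order_stat X j) <=
    psi (carry m) * \prod_(j < m) psi (order_stat (x :: X) j).
  elim: m => [|m IHm].
    rewrite !big_ord0 !mulr1 (_ : carry 0%N = x) //.
    by apply/ffunP => i; rewrite ffunE andbT.
  rewrite !big_ord_recr /= mulrA.
  apply: le_trans (ler_wpM2r (psi0 _) IHm) _.
  rewrite mulrAC [leRHS]mulrA [leRHS]mulrAC.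
  apply: ler_wpM2r; first by apply: prodr_ge0.
  apply: le_trans (psi_lsm _ _) _.
  have -> : cmeet (carry m) (order_stat X m) = carry m.+1.
    apply/ffunP => i; rewrite !ffunE; case: (x i) => //=.
    by case: ltnP => [/ltnW ->|]; rewrite ?andbF.
  have -> : cjoin (carry m) (order_stat X m) = order_stat (x :: X) m.
    apply/ffunP => i; rewrite !ffunE /=.
    case: (x i); rewrite /= ?add0n // add1n ltnS.
    by rewrite orb_idr // => /ltnW.
  by [].

rewrite big_cons /= big_ord_recr /= mulrC.
apply: le_trans (ler_wpM2r (psi0 _) IH) _; rewrite mulrC.
apply: le_trans (step _) _; rewrite mulrC.
(* The final remainder is 1 exactly where [x] and all of [X] are, which is the last order
   statistic. *)
rewrite (_ : carry _ = order_stat (x :: X) (size X)) //.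
apply/ffunP => i; rewrite !ffunE /=.
have := count_size (fun y : config I => y i) X.
by case: (x i) => /=; rewrite ?add1n // add0n ltnNge => ->.
Qed.

(** * Marginals and the four functions theorem *)

Definition agree_off (I : finType) (P : pred I) (x y : config I) : bool :=
  [forall i, P i || (x i == y i)].

(** Kept as a function on all of [config I], constant in the coordinates of [P], so that successive
    summations compose without a change of type. *)
Definition marginal (R : realType) (I : finType) (P : pred I)
    (g : config I -> R) (y : config I) : R :=
  \sum_(x | agree_off P x y) g x.

Lemma eq_marginal (R : realType) (I : finType) (P Q : pred I)
    (g : config I -> R) (y : config I) :
  P =1 Q -> marginal P g y = marginal Q g y.
Proof.
move=> PQ; apply: eq_bigl => x.
by apply: eq_forallb => i; rewrite PQ.
Qed.

Lemma marginal_ge0 (R : realType) (I : finType) (P : pred I)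
    (g : config I -> R) (y : config I) :
  (forall x, 0 <= g x) -> 0 <= marginal P g y.
Proof. by move=> g0; apply: sumr_ge0. Qed.

Lemma marginal_pred0 (R : realType) (I : finType) (g : config I -> R)
    (y : config I) : marginal pred0 g y = g y.
Proof.
rewrite /marginal (eq_bigl (pred1 y)) ?big_pred1_eq // => x /=.
apply/forallP/eqP => [xy|-> i]; last by rewrite eqxx.
by apply/ffunP => i; apply/eqP/xy.
Qed.

Lemma marginal_predT (R : realType) (I : finType) (g : config I -> R)
    (y : config I) : marginal predT g y = partition_function g.
Proof.
by apply: eq_bigl => x; apply/forallP.
Qed.

Lemma marginalU (R : realType) (I : finType) (P Q : pred I)
    (g : config I -> R) (y : config I) :
  (forall i, Q i -> ~~ P i) ->
  marginal (predU P Q) g y = marginal Q (marginal P g) y.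
Proof.
move=> QP; rewrite /marginal.
(* The index of the outer sum: coordinates in [Q] from [x], the others from [y]. *)
pose merge (x : config I) : config I := [ffun i => if Q i then x i else y i].
rewrite (partition_big merge (fun x' => agree_off Q x' y)) /=; last first.
  move=> x _; apply/forallP => i; rewrite ffunE.
  by case: (Q i) => //=; rewrite eqxx.
apply: eq_bigr => x' /forallP x'y; apply: eq_bigl => x.
apply/andP/forallP => [[/forallP xy /eqP <- i]|xx'].
  rewrite ffunE; move: (xy i) => /=.
  by case: (P i); case: (Q i) => //=; rewrite ?eqxx.
split.
  apply/forallP => i /=; move: (xx' i) (x'y i) (QP i).
  by case: (P i); case: (Q i) => //= /eqP -> /eqP -> _; rewrite eqxx.
apply/eqP/ffunP => i; rewrite ffunE; move: (xx' i) (x'y i) (QP i).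
case: (Q i); case: (P i) => //=; do ?[by move=> _ _ /(_ isT)].
- by move=> /eqP.
- by move=> _ /eqP.
by move=> _ /eqP.
Qed.

Definition upd (I : finType) (x : config I) (i : I) (b : bool) : config I :=
  [ffun j => if j == i then b else x j].

Lemma marginal1 (R : realType) (I : finType) (i : I) (g : config I -> R)
    (y : config I) : marginal (pred1 i) g y = g (upd y i false) + g (upd y i true).
Proof.
rewrite /marginal (bigD1 (upd y i false)) /=; last first.
  by apply/forallP => j; rewrite ffunE /=; case: (j == i) => //=; rewrite eqxx.
congr (_ + _); rewrite (eq_bigl (pred1 (upd y i true))) ?big_pred1_eq // => x /=.
apply/andP/eqP => [[/forallP xy]|->]; last first.
  split.
    by apply/forallP => j; rewrite ffunE /=; case: (j == i) => //=; rewrite eqxx.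
  by apply/eqP => /ffunP/(_ i); rewrite !ffunE eqxx.
move=> xN; have xi : x i.
  apply: contraNT xN => /negbTE xi; apply/eqP/ffunP => j; rewrite ffunE.
  by have := xy j => /=; case: eqP => [->|_ /eqP].
apply/ffunP => j; rewrite ffunE; have := xy j => /=.
by case: eqP => [->|_ /eqP].
Qed.

(* The cross terms are both at most c0 * d1 and have product at most
   (c0 * d1) * (c1 * d0). *)
Lemma four_functions_bool (R : realType) (a0 a1 b0 b1 c0 c1 d0 d1 : R) :
  0 <= a0 -> 0 <= a1 -> 0 <= b0 -> 0 <= b1 ->
  0 <= c0 -> 0 <= c1 -> 0 <= d0 -> 0 <= d1 ->
  a0 * b0 <= c0 * d0 -> a1 * b1 <= c1 * d1 ->
  a0 * b1 <= c0 * d1 -> a1 * b0 <= c0 * d1 ->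
  (a0 + a1) * (b0 + b1) <= (c0 + c1) * (d0 + d1).
Proof.
move=> a00 a10 b00 b10 c00 c10 d00 d10 h00 h11 h01 h10.
have cross (u v m l : R) : 0 <= u -> 0 <= v -> 0 <= l -> u <= m -> v <= m ->
    u * v <= m * l -> u + v <= m + l.
  move=> u0 v0 l0 um vm uv; have [m_gt0|] := ltP 0 m; last by lra.
  rewrite -(ler_pM2l m_gt0).
  (* Expanded, and combined with [u * v <= m * l], this gives [m * (u + v) <= m * (m + l)]. *)
  have : 0 <= (m - u) * (m - v) by rewrite mulr_ge0 ?subr_ge0.
  by lra.
have {}cross : a0 * b1 + a1 * b0 <= c0 * d1 + c1 * d0.
  apply: cross; rewrite ?mulr_ge0 //.
  have -> : a0 * b1 * (a1 * b0) = (a0 * b0) * (a1 * b1) by ring.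
  have -> : c0 * d1 * (c1 * d0) = (c0 * d0) * (c1 * d1) by ring.
  by apply: ler_pM => //; apply: mulr_ge0.
by rewrite !mulrDl !mulrDr; lra.
Qed.

(** Two different bits at [i] have meet 0 and join 1, so both cross products are bounded by the same
    term, as [four_functions_bool] requires. *)
Lemma log_supermodular_marginal1 (R : realType) (I : finType) (i : I)
    (g : config I -> R) :
  (forall x, 0 <= g x) -> log_supermodular g ->
  log_supermodular (marginal (pred1 i) g).
Proof.
move=> g0 glsm x y; rewrite !marginal1.
have upd_meet a b : cmeet (upd x i a) (upd y i b) = upd (cmeet x y) i (a && b).
  by apply/ffunP => j; rewrite !ffunE; case: eqP.
have upd_join a b : cjoin (upd x i a) (upd y i b) = upd (cjoin x y) i (a || b).
  by apply/ffunP => j; rewrite !ffunE; case: eqP.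
have h a b := glsm (upd x i a) (upd y i b).
apply: four_functions_bool => //.
- by have := h false false; rewrite upd_meet upd_join.
- by have := h true true; rewrite upd_meet upd_join.
- by have := h false true; rewrite upd_meet upd_join.
- by have := h true false; rewrite upd_meet upd_join.
Qed.

Lemma log_supermodular_marginal (R : realType) (I : finType) (P : pred I)
    (g : config I -> R) :
  (forall x, 0 <= g x) -> log_supermodular g -> log_supermodular (marginal P g).
Proof.
move=> g0 glsm.
have main s : uniq s -> log_supermodular (marginal (mem s) g).
  elim: s => [_|i s IH /= /andP[is_ us]] x y.
    rewrite !(eq_marginal (P := mem [::]) (Q := pred0)) // !marginal_pred0; exact: glsm.
  have E z : marginal (mem (i :: s)) g z = marginal (pred1 i) (marginal (mem s) g) z.
    rewrite -marginalU; last by move=> j /eqP ->.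
    by apply: eq_marginal => j; rewrite /= inE orbC.
  rewrite !E; apply: log_supermodular_marginal1 (IH us) _ _ => z.
  exact: marginal_ge0.
move=> x y; have E z : marginal P g z = marginal (mem (enum P)) g z.
  by apply: eq_marginal => j; rewrite /= mem_enum.
by rewrite !E; apply: main; rewrite enum_uniq.
Qed.

(** * The inequality for one vertex *)

(** Summation by parts gives [a n * b n] plus the sum of [(a j - a j.+1) * b j], all nonnegative;
    the induction keeps the last term as a lower bound. *)
Lemma abel_sum_ge0 (R : realType) (n : nat) (a b : nat -> R) :
  (forall j, (j <= n)%N -> 0 <= a j) -> (forall j, (j <= n)%N -> 0 <= b j) ->
  (forall j, (j < n)%N -> a j.+1 <= a j) ->
  0 <= a 0%N * b 0%N + \sum_(j < n) a j.+1 * (b j.+1 - b j).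
Proof.
move=> a0 b0 a_dec.
suff main m : (m <= n)%N ->
    a m * b m <= a 0%N * b 0%N + \sum_(j < m) a j.+1 * (b j.+1 - b j).
  by apply: le_trans (main n (leqnn n)); rewrite mulr_ge0 ?a0 ?b0.
elim: m => [_|m IH lt_mn]; first by rewrite big_ord0 addr0.
rewrite big_ord_recr /= addrA -lerBlDr; apply: le_trans (IH (ltnW lt_mn)).
rewrite mulrBr subKr; apply: ler_wpM2r; first exact/b0/ltnW.
exact: a_dec.
Qed.

(** This is [ln u <= u - 1] at [u = b / a]; summed over configurations it becomes Gibbs' inequality
    for unnormalised measures. *)
Lemma sub_le_mul_sub_ln (R : realType) (a b : R) :
  0 < a -> 0 < b -> a - b <= a * (ln a - ln b).
Proof.
move=> a0 b0; have : ln (1 + (b / a - 1)) <= b / a - 1.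
  by apply: le_ln1Dx; rewrite ltrBrDr addNr divr_gt0.
rewrite addrC subrK ln_div // -(ler_pM2l a0) [leRHS]mulrBr mulr1 [b / a]mulrC.
by rewrite mulVKf ?gt_eqF // !mulrBr; lra.
Qed.

Lemma ln_prod (R : realType) (J : Type) (r : seq J) (P : pred J) (F : J -> R) :
  (forall j, P j -> 0 < F j) ->
  ln (\prod_(j <- r | P j) F j) = \sum_(j <- r | P j) ln (F j).
Proof.
move=> F0; suff [] : 0 < \prod_(j <- r | P j) F j /\
    ln (\prod_(j <- r | P j) F j) = \sum_(j <- r | P j) ln (F j) by [].
elim/big_rec2: _ => [|j x y Pj [y0 <-]]; first by rewrite ln1.
by rewrite lnM ?posrE ?mulr_gt0 ?F0.
Qed.

Lemma sum_le_prod_gt0 (R : realType) (I : finType) (i0 : I)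
    (F : config I -> R) (p q : nat -> R) :
  (forall x, 0 < F x) -> log_supermodular F ->
  (forall j, (j < #|I|)%N -> 0 < p j) -> (forall j, (j < #|I|)%N -> 0 < q j) ->
  (forall x, F x <=
     \prod_(j < #|I|) (if (j < #|[set i | x i]|)%N then p j else q j)) ->
  \sum_x F x <= \prod_(j < #|I|) (q j + p j).
Proof.
move=> F0 Flsm p0 q0 FB.
pose d i := \sum_(x : config I) F x * (x i)%:R.
pose s := sort (fun u v => d v <= d u) (enum I).
have s_perm : perm_eq s (enum I) by rewrite perm_sort.
have s_size : size s = #|I| by rewrite (perm_size s_perm) -cardE.
have s_uniq : uniq s by rewrite (perm_uniq s_perm) enum_uniq.
have s_mem i : i \in s by rewrite (perm_mem s_perm) mem_enum.
have s_index i : (index i s < #|I|)%N by rewrite -s_size index_mem.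
pose e j := nth i0 s j.
have e_index j : (j < #|I|)%N -> index (e j) s = j.
  by move=> lt_j; rewrite index_uniq ?s_size.
have d_dec j : (j.+1 < #|I|)%N -> d (e j.+1) <= d (e j).
  move=> lt_j; have s_sorted : sorted (fun u v => d v <= d u) s.
    by apply: sort_sorted => u v; exact: le_total.
  by apply: (sortedP i0 s_sorted); rewrite s_size.
have prod_e (G : nat -> I -> R) :
    \prod_(j < #|I|) G j (e j) = \prod_i G (index i s) i.
  rewrite -[RHS]big_enum -(perm_big _ s_perm) /= (big_nth i0) big_mkord s_size.
  by apply: eq_bigr => j _; rewrite e_index.
(* The chain of initial segments in the order of decreasing marginals [d]. *)
pose P m : config I := [ffun i => index i s < m]%N.
have P_card m : (m <= #|I|)%N -> #|[set i | P m i]| = m.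
  move=> le_m; rewrite -[RHS](@size_takel m _ s) ?s_size //.
  rewrite -(card_uniqP (take_uniq m s_uniq)); apply: eq_card => i.
  by rewrite inE ffunE in_take.
pose L x := ln (F x).
have L_sm x y : L x + L y <= L (cmeet x y) + L (cjoin x y).
  rewrite /L -!lnM ?posrE ?F0 // ler_ln ?posrE ?mulr_gt0 ?F0 //; exact: Flsm.
(* Adding e j to a subset of P j increases L by at most what adding it to P j
   itself does. *)
have greedy x m : (m <= #|I|)%N -> L (cmeet x (P m)) <=
    L (P 0%N) + \sum_(j < m) (x (e j))%:R * (L (P j.+1) - L (P j)).
  elim: m => [_|m IH lt_m].
    rewrite big_ord0 addr0 (_ : cmeet _ _ = P 0%N) //.
    by apply/ffunP => i; rewrite !ffunE andbF.
  rewrite big_ord_recr /= addrA; have := IH (ltnW lt_m).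
  have index_m i : (index i s == m) = (i == e m).
    by apply/eqP/eqP => [<-|->]; rewrite ?e_index // /e nth_index.
  case xm : (x (e m)); last first.
    rewrite mul0r addr0 (_ : cmeet x (P m.+1) = cmeet x (P m)) //.
    apply/ffunP => i; rewrite !ffunE ltnS leq_eqVlt index_m.
    by case: eqP => [->|//]; rewrite xm.
  have := L_sm (cmeet x (P m.+1)) (P m).
  rewrite (_ : cmeet (cmeet _ _) _ = cmeet x (P m)); last first.
    apply/ffunP => i; rewrite !ffunE -andbA; congr (_ && _).
    by apply: andb_idl => /ltnW; rewrite ltnS.
  rewrite (_ : cjoin (cmeet _ _) _ = P m.+1); last first.
    apply/ffunP => i; rewrite !ffunE ltnS (leq_eqVlt (index i s) m) index_m.
    by case: eqP => [->|_] /=; [rewrite xm | rewrite orb_idl // => /andP[]].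
  rewrite mul1r; lra.
pose Z := \sum_x F x.
(* The logarithm of the assumed bound at a configuration with [m] ones. *)
pose lb m := \sum_(j < #|I|) ln (if (j < m)%N then p j else q j).
have pq0 j (b : bool) : (j < #|I|)%N -> 0 < (if b then p j else q j).
  by move=> lt_j; case: b; [exact: p0 | exact: q0].
have lbS m : (m < #|I|)%N -> lb m.+1 - lb m = ln (p m) - ln (q m).
  move=> lt_m; rewrite /lb -sumrB (bigD1 (Ordinal lt_m)) //= ltnSn ltnn.
  rewrite big1 ?addr0 // => j; rewrite -val_eqE /= => ne_jm.
  by rewrite ltnS leq_eqVlt (negbTE ne_jm) subrr.
have lb_ge m : (m <= #|I|)%N -> 0 <= lb m - L (P m).
  move=> le_m; rewrite subr_ge0 /lb -ln_prod; last by move=> j _; exact: pq0.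
  rewrite /L ler_ln ?posrE ?F0 //; last by apply: prodr_gt0 => j _; exact: pq0.
  by have := FB (P m); rewrite P_card.
(* Independent bits: the coordinate of rank [j] has weights [q j] and [p j]. Hence [ln W] is affine
   in the bits, with the increments of [lb] as slopes. *)
pose W (x : config I) := \prod_(j < #|I|) (if x (e j) then p j else q j).
have W0 x : 0 < W x by apply: prodr_gt0 => j _; exact: pq0.
have lnW x : ln (W x) = lb 0%N + \sum_(j < #|I|) (x (e j))%:R * (lb j.+1 - lb j).
  rewrite /W ln_prod; last by move=> j _; exact: pq0.
  rewrite /lb -big_split; apply: eq_bigr => j _ /=.
  by rewrite lbS //; case: (x _); rewrite /= ?mul1r ?mul0r ?addr0 // addrC subrK.
(* Averages of affine functions of the bits see [F] only through [Z] and the marginals [d]. *)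
have sumF (c : R) (f : nat -> R) :
    \sum_x F x * (c + \sum_(j < #|I|) (x (e j))%:R * f j) =
    Z * c + \sum_(j < #|I|) d (e j) * f j.
  rewrite /Z mulr_suml; under eq_bigr do rewrite mulrDr mulr_sumr.
  rewrite big_split /=; congr (_ + _).
  rewrite exchange_big /=; apply: eq_bigr => j _.
  by rewrite /d mulr_suml; apply: eq_bigr => x _; rewrite mulrA.
have FL_le : \sum_x F x * L x <= \sum_x F x * ln (W x).
  apply: (@le_trans _ _ (\sum_x F x * (L (P 0%N) +
     \sum_(j < #|I|) (x (e j))%:R * (L (P j.+1) - L (P j))))).
    apply: ler_sum => x _; rewrite ler_pM2l //.
    apply: le_trans (greedy x #|I| (leqnn _)).
    rewrite (_ : cmeet _ _ = x) //; apply/ffunP => i.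
    by rewrite !ffunE s_index andbT.
  under [leRHS]eq_bigr do rewrite lnW.
  rewrite (sumF _ (fun j => L (P j.+1) - L (P j))) (sumF _ (fun j => lb j.+1 - lb j)).
  rewrite -subr_ge0.
  (* Total mass first, then the marginals in decreasing order: the weights for [abel_sum_ge0],
     applied to the gaps [lb m - L (P m)]. *)
  pose a j := if j is j'.+1 then d (e j') else Z.
  have d0 i : 0 <= d i by apply: sumr_ge0 => x _; rewrite mulr_ge0 ?ler0n ?ltW.
  have dZ i : d i <= Z.
    by apply: ler_sum => x _; apply: ler_piMr; [exact: ltW | rewrite lern1 leq_b1].
  have Z0 : 0 <= Z by apply: sumr_ge0 => x _; rewrite ltW.
  have h : 0 <= a 0%N * (lb 0%N - L (P 0%N)) +
      \sum_(j < #|I|) a j.+1 * (lb j.+1 - L (P j.+1) - (lb j - L (P j))).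
    apply: (abel_sum_ge0 (b := fun m => lb m - L (P m))) => //.
      by case=> [|j] _; [exact: Z0 | exact: d0].
    by case=> [|j] lt_j; [exact: dZ | exact: d_dec].
  apply: le_trans h _; rewrite /= le_eqVlt; apply/orP; left; apply/eqP.
  rewrite opprD addrACA -mulrBr; congr (_ + _).
  by rewrite -sumrB; apply: eq_bigr => j _; rewrite -mulrBr; congr (_ * _); lra.
have -> : \prod_(j < #|I|) (q j + p j) = \sum_x W x.
  rewrite (prod_e (fun j _ => q j + p j)).
  under [RHS]eq_bigr => x _ do rewrite /W (prod_e (fun j i => if x i then p j else q j)).
  rewrite -(bigA_distr_bigA (fun i b => if b then p (index i s) else q (index i s))).
  by apply: eq_bigr => i _; rewrite big_bool /= addrC.
rewrite -subr_ge0 -sumrB.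
have : \sum_x (F x - W x) <= \sum_x (F x * (L x - ln (W x))).
  by apply: ler_sum => x _; exact: sub_le_mul_sub_ln.
under [X in _ <= X]eq_bigr do rewrite mulrBr.
rewrite !sumrB; lra.
Qed.

(** The indices counted are those between [a] and [b]. Subtraction is truncated, so the two
    differences add up to an absolute value. *)
Lemma sum_xor_ltn (n a b : nat) :
  (\sum_(j < n) ((j < a) (+) (j < b)) =
   (minn n a - minn n b) + (minn n b - minn n a))%N.
Proof.
elim: n => [|n IH]; first by rewrite big_ord0 !min0n.
rewrite big_ord_recr IH /=; clear IH.
by case: (ltnP n a); case: (ltnP n b) => /=; lia.
Qed.

Lemma expr1D_le_linear (R : realType) (n : nat) :
  exists2 c : R, 0 <= c &
    forall e, 0 <= e -> e <= 1 -> (1 + e) ^+ n <= 1 + c * e.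
Proof.
elim: n => [|n [c c0 IH]].
  by exists 0 => // e _ _; rewrite expr0 mul0r addr0.
(* From (1 + ce)(1 + e) = 1 + (c + 1)e + ce^2 and e^2 <= e. *)
exists (2 * c + 1); first by lra.
move=> e e0 e1; rewrite exprSr.
apply: (@le_trans _ _ ((1 + c * e) * (1 + e))).
  by apply: ler_wpM2r; [lra | exact: IH].
have : c * e * e <= c * e by rewrite ler_piMr // mulr_ge0.
by lra.
Qed.

Lemma sum_le_prod (R : realType) (I : finType) (i0 : I)
    (F : config I -> R) (p q : nat -> R) :
  (forall x, 0 <= F x) -> log_supermodular F ->
  (forall j, (j < #|I|)%N -> 0 <= p j) -> (forall j, (j < #|I|)%N -> 0 <= q j) ->
  (forall x, F x <=
     \prod_(j < #|I|) (if (j < #|[set i | x i]|)%N then p j else q j)) ->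
  \sum_x F x <= \prod_(j < #|I|) (q j + p j).
Proof.
move=> F0 Flsm p0 q0 FB.
have C0 : 0 <= \prod_(j < #|I|) (q j + p j).
  by apply: prodr_ge0 => j _; rewrite addr_ge0 ?p0 ?q0.
have [/forallP F_eq0|] := boolP [forall x, F x == 0].
  by rewrite big1 // => x _; apply/eqP.
rewrite negb_forall => /existsP[s0 Fs0]; have {}Fs0 : 0 < F s0 by rewrite lt0r Fs0 F0.
(* A positive value of [F] excludes [p j = q j = 0]; this makes the perturbed weights below
   positive. *)
have pq_gt0 j : (j < #|I|)%N -> 0 < p j \/ 0 < q j.
  move=> lt_j; have := lt_le_trans Fs0 (FB s0).
  rewrite (bigD1 (Ordinal lt_j)) //=; case: ifP => _.
    rewrite (lt0r (p j)) p0 // andbT; case: eqP => [->|]; last by left.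
    by rewrite mul0r ltxx.
  rewrite (lt0r (q j)) q0 // andbT; case: eqP => [->|]; last by right.
  by rewrite mul0r ltxx.
pose dist (s x : config I) := (\sum_i (s i (+) x i))%N.
have dist_card (s x : config I) : (#|[set i | s i]| <= #|[set i | x i]| + dist s x)%N.
  rewrite -!sum1dep_card big_mkcond [X in (_ <= X + _)%N]big_mkcond -big_split.
  by apply: leq_sum => i _ /=; case: (s i); case: (x i).
have distC s x : dist s x = dist x s by apply: eq_bigr => i _; rewrite addbC.
have smooth e : 0 < e -> e <= 1 ->
    \sum_x F x <= \prod_(j < #|I|) (q j + p j) * (1 + e) ^+ #|I|.
  move=> e_gt0 e_le1; have e_ge0 := ltW e_gt0.
  (* The sup-convolution of F with e ^ (Hamming distance) is positive and still
     log-supermodular; e tends to 0 at the end. *)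
  pose K (x s : config I) := F s * e ^+ dist s x.
  pose Fe x := K x [arg max_(s > x) K x s]%O.
  have Fe_ge x s : K x s <= Fe x.
    by rewrite /Fe; case: arg_maxP => // s' _; apply.
  have F_le x : F x <= Fe x.
    apply: le_trans (Fe_ge x x); rewrite /K (_ : dist x x = 0%N) ?mulr1 //.
    by rewrite /dist big1 // => i _; rewrite addbb.
  have Fe_lsm : log_supermodular Fe.
    move=> x y; rewrite {1 2}/Fe; set s := [arg max_(s > x) _]%O.
    set t := [arg max_(s > y) _]%O.
    apply: (@le_trans _ _ (K (cmeet x y) (cmeet s t) * K (cjoin x y) (cjoin s t))).
      rewrite /K mulrACA [leRHS]mulrACA -!exprD.
      apply: ler_pM; rewrite ?mulr_ge0 ?exprn_ge0 //.
      (* Bit by bit, the distance between the meets plus that between the joins is at most the sum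
         of the original distances. *)
      apply: ler_wiXn2l => //; rewrite /dist -!big_split; apply: leq_sum => i _.
      by rewrite /= !ffunE; case: (s i); case: (t i); case: (x i); case: (y i).
    by apply: ler_pM; rewrite ?Fe_ge // /K mulr_ge0 ?exprn_ge0.
  apply: (@le_trans _ _ (\sum_x Fe x)); first exact: ler_sum.
  (* Mixing [p j] and [q j] in ratio [e] multiplies each [q j + p j] by exactly 1 + e. *)
  apply: (@le_trans _ _ (\prod_(j < #|I|) ((q j + e * p j) + (p j + e * q j)))).
    apply: (sum_le_prod_gt0 i0 (p := fun j => p j + e * q j)
                               (q := fun j => q j + e * p j)) => //.
    - move=> x; apply: lt_le_trans (Fe_ge x s0).
      by rewrite mulr_gt0 ?exprn_gt0.
    - move=> j lt_j; have := mulr_ge0 e_ge0 (q0 _ lt_j); have := p0 _ lt_j.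
      by case: (pq_gt0 _ lt_j) => [|h]; [lra | have := mulr_gt0 e_gt0 h; lra].
    - move=> j lt_j; have := mulr_ge0 e_ge0 (p0 _ lt_j); have := q0 _ lt_j.
      by case: (pq_gt0 _ lt_j) => [h|]; [have := mulr_gt0 e_gt0 h; lra | lra].
    move=> x; rewrite {1}/Fe; set s := [arg max_(s > x) _]%O.
    (* The numbers of ones in [s] and [x] differ by at most [dist s x], so there is a factor [e] for
       each [j] at which the choice between [p j] and [q j] changes. *)
    apply: (@le_trans _ _ (\prod_(j < #|I|)
      ((if (j < #|[set i | s i]|)%N then p j else q j) *
       e ^+ ((j < #|[set i | s i]|) (+) (j < #|[set i | x i]|))%N))).
      rewrite big_split; apply: ler_pM; rewrite ?exprn_ge0 //.
      rewrite prodrXr; apply: ler_wiXn2l => //; rewrite sum_xor_ltn.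
      rewrite !(minn_idPr (max_card _)).
      have := dist_card s x; have := dist_card x s; rewrite distC.
      by move: #|_| #|_| (dist _ _) => a b c; lia.
    apply: ler_prod => j _; have pj := p0 _ (ltn_ord j); have qj := q0 _ (ltn_ord j).
    have epj := mulr_ge0 e_ge0 pj; have eqj := mulr_ge0 e_ge0 qj.
    by case: ifP => _; case: ifP => _; rewrite /= ?expr0 ?expr1; apply/andP; split; lra.
  rewrite -[#|I| in X in _ * _ ^+ X]card_ord -prodr_const -big_split.
  by rewrite le_eqVlt; apply/orP; left; apply/eqP/eq_bigr => j _ /=; ring.
set C := \prod_(j < #|I|) _ in C0 smooth *.
have [c c0 c_lin] := expr1D_le_linear R #|I|.
apply/ler_addgt0Pr => e e0.
have Cc : 0 < C * c + 1 by have := mulr_ge0 C0 c0; lra.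
(* Chosen so that [C * (1 + c * h) <= C + e]; the added 1 keeps the denominator positive. *)
pose h := Num.min 1 (e / (C * c + 1)).
have h0 : 0 < h by rewrite lt_min ltr01 divr_gt0.
have h1 : h <= 1 by rewrite ge_min lexx.
have hC : (C * c + 1) * h <= e by rewrite mulrC -ler_pdivlMr // ge_min lexx orbT.
apply: le_trans (smooth h h0 h1) _.
apply: le_trans (ler_wpM2l C0 (c_lin h (ltW h0) h1)) _.
by lra.
Qed.

(** * Summing out one fibre at a time *)

Definition fiber_stat (V W : finType) (pi : W -> V) (y : config W) (j : nat) :
  config V := [ffun i => j < #|[set w | (pi w == i) && y w]|]%N.

(** With [y] frozen off the fibre of [i], [g] is a log-supermodular function of k bits whose bound
    depends only on the number of ones, so [sum_le_prod] applies. *)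
Lemma marginal_fiber_le (R : realType) (V W : finType) (pi : W -> V) (k : nat)
    (i : V) (f : config V -> R) (g : config W -> R) (y : config W) :
  (0 < k)%N -> #|[set w | pi w == i]| = k ->
  (forall y, 0 <= g y) -> log_supermodular g -> (forall x, 0 <= f x) ->
  (forall y, g y <= \prod_(j < k) f (fiber_stat pi y j)) ->
  marginal (fun w => pi w == i) g y <=
    \prod_(j < k) marginal (pred1 i) f (fiber_stat pi y j).
Proof.
move=> k0 cardk g0 glsm f0 gf; pose C : finType := {w | pi w == i}.
have cardC : #|C| = k by rewrite card_sig -cardk cardsE.
pose glue (t : config C) : config W :=
  [ffun w => if insub w is Some c then t c else y w].
pose restr (x : config W) : config C := [ffun c => x (val c)].
have glue_val t c : glue t (val c) = t c by rewrite ffunE valK.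
have glue_out t w : pi w != i -> glue t w = y w by move=> ne; rewrite ffunE insubN.
have -> : marginal (fun w => pi w == i) g y = \sum_t g (glue t).
  rewrite /marginal (reindex_onto glue restr) /=.
    apply: eq_bigl => t; apply/andP; split.
      apply/forallP => w; case: (boolP (pi w == i)) => //= /glue_out ->.
      by rewrite eqxx.
    by apply/eqP/ffunP => c; rewrite ffunE glue_val.
  move=> x /forallP xy; apply/ffunP => w; have [pw|npw] := boolP (pi w == i).
    by rewrite -[w]/(val (Sub w pw : C)) glue_val ffunE.
  by rewrite glue_out //; have := xy w; rewrite (negbTE npw) => /eqP.
(* Changing [y] on the fibre alters each [fiber_stat] only at [i]. *)
have stat_glue t j : fiber_stat pi (glue t) j =
    upd (fiber_stat pi y j) i (j < #|[set c | t c]|)%N.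
  apply/ffunP => i'; rewrite !ffunE; case: eqP => [->|ne].
    rewrite -(card_imset [set c | t c] val_inj); congr (_ < _)%N.
    apply: eq_card => w; rewrite inE; apply/andP/imsetP => [[pw]|[c]].
      rewrite -[w]/(val (Sub w pw : C)) glue_val => tw.
      by exists (Sub w pw : C); rewrite ?inE.
    by rewrite inE => tc ->; rewrite glue_val (valP c).
  congr (_ < _)%N; apply: eq_card => w; rewrite !inE.
  by case: eqP => //= pw; rewrite glue_out // pw; apply/eqP.
have /card_gt0P[c0 _] : (0 < #|C|)%N by rewrite cardC.
pose p j := f (upd (fiber_stat pi y j) i true).
pose q j := f (upd (fiber_stat pi y j) i false).
rewrite -cardC; under [leRHS]eq_bigr do rewrite marginal1.
apply: (sum_le_prod c0 (F := fun t => g (glue t)) (p := p) (q := q)) => //.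
(* Gluing commutes with meet and join, because [y] is its own meet and join with itself. *)
- move=> s t; apply: le_trans (glsm _ _) _; rewrite le_eqVlt; apply/orP; left.
  by apply/eqP; congr (g _ * g _); apply/ffunP => w; rewrite !ffunE;
    case: insub => [c|]; rewrite ?ffunE ?andbb ?orbb.
- by move=> j _; exact: f0.
- by move=> j _; exact: f0.
move=> t; apply: le_trans (gf _) _; rewrite cardC le_eqVlt; apply/orP; left.
by apply/eqP/eq_bigr => j _; rewrite stat_glue /p /q; case: ifP.
Qed.

(** The domination of [g] by the product over [fiber_stat] survives summing out a vertex of [V]
    together with its fibre; it is the invariant of an induction over the vertices. *)
Lemma partition_function_fiber_le (R : realType) (V W : finType) (pi : W -> V)
    (k : nat) (f : config V -> R) (g : config W -> R) :
  (0 < k)%N -> (forall i, #|[set w | pi w == i]| = k) ->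
  (forall y, 0 <= g y) -> log_supermodular g -> (forall x, 0 <= f x) ->
  (forall y, g y <= \prod_(j < k) f (fiber_stat pi y j)) ->
  partition_function g <= partition_function f ^+ k.
Proof.
move=> k0 cardk g0 glsm f0 gf.
have main s : uniq s -> forall y, marginal (fun w => pi w \in s) g y <=
    \prod_(j < k) marginal (mem s) f (fiber_stat pi y j).
  elim: s => [_ y|i s IH /= /andP[is_ us] y].
    rewrite (eq_marginal (Q := pred0)) // marginal_pred0.
    apply: le_trans (gf y) _; apply: ler_prod => j _; rewrite f0 /=.
    by rewrite (eq_marginal (Q := pred0)) // marginal_pred0.
  rewrite (eq_marginal (Q := predU (fun w => pi w \in s) (fun w => pi w == i))).
    rewrite marginalU => [|w /eqP -> //].
    under eq_bigr => j _.
      rewrite (eq_marginal (Q := predU (mem s) (pred1 i))).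
        rewrite marginalU => [|i' /eqP -> //].
        over.
      by move=> i'; rewrite /= inE orbC.
    apply: marginal_fiber_le => //; last exact: IH.
    - by move=> y'; apply: marginal_ge0.
    - exact: log_supermodular_marginal.
    by move=> x; apply: marginal_ge0.
  by move=> w; rewrite /= inE orbC.
(* Any configuration serves here: once all coordinates are summed out, the marginals are
   constant. *)
have := main (enum V) (enum_uniq V) [ffun _ => false].
rewrite (eq_marginal (Q := predT)); last by move=> w; rewrite /= mem_enum.
rewrite marginal_predT; under eq_bigr => j _.
  rewrite (eq_marginal (Q := predT)); last by move=> w; rewrite /= mem_enum.
  rewrite marginal_predT; over.
by rewrite prodr_const card_ord.
Qed.

(** * Log-supermodularity and domination of the cover function *)

Lemma log_supermodularM (R : realType) (I : finType) (F G : config I -> R) :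
  (forall x, 0 <= F x) -> (forall x, 0 <= G x) ->
  log_supermodular F -> log_supermodular G ->
  log_supermodular (fun x => F x * G x).
Proof.
move=> F0 G0 Flsm Glsm x y; rewrite mulrACA [leRHS]mulrACA.
by apply: ler_pM; rewrite ?mulr_ge0.
Qed.

(** On one bit, meet and join are the two given values in some order, so equality holds. *)
Lemma log_supermodular_eval (R : realType) (I : finType) (i : I) (a : bool -> R) :
  log_supermodular (fun x : config I => a (x i)).
Proof. by move=> x y; rewrite !ffunE; case: (x i); case: (y i); rewrite //= mulrC. Qed.

(** Sorting only permutes the bits, so one-variable potentials lose nothing. *)
Lemma prod_sorted_bits (R : realType) (a : bool -> R) (s : seq bool) :
  \prod_(b <- s) a b = \prod_(j < size s) a (j < count id s)%N.
Proof.
elim: s => [|b s IH]; first by rewrite big_nil big_ord0.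
rewrite big_cons IH /=; case: b; first by rewrite big_ord_recl.
by rewrite big_ord_recr /= add0n ltnNge count_size mulrC.
Qed.

Lemma prod_fiber_bits (R : realType) (V W : finType) (pi : W -> V) (k : nat)
    (i : V) (a : bool -> R) (y : config W) :
  #|[set w | pi w == i]| = k ->
  \prod_(w | pi w == i) a (y w) = \prod_(j < k) a (fiber_stat pi y j i).
Proof.
move=> cardk; rewrite -big_enum -(big_map y xpredT).
rewrite prod_sorted_bits size_map -cardE -cardk cardsE.
apply: eq_bigr => j _; rewrite ffunE count_map -sum1_count big_enum_cond /=.
by rewrite sum1dep_card.
Qed.

Section Cover.
Variables (R : realType) (V : finType) (A : {set {set V}}).
Variables (phi : V -> bool -> R).
Variable psi : forall alpha : {set V}, config {i : V | i \in alpha} -> R.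
Variables (k : nat) (H : graph) (h : H -> factor_graph A).
Hypothesis h_kcover : kcover k h.
Hypothesis phi0 : forall i b, 0 <= phi i b.
Hypothesis psi0 : forall alpha, alpha \in A -> forall x, 0 <= psi (alpha := alpha) x.
Hypothesis psi_lsm :
  forall alpha, alpha \in A -> log_supermodular (psi (alpha := alpha)).

Local Notation W := (var_node h).
Local Notation g := (cover_function phi psi (h := h)).

Lemma cover_function_ge0 y : 0 <= g y.
Proof.
apply: mulr_ge0; apply: prodr_ge0 => i _; apply: prodr_ge0 => w _ //.
exact/psi0/valP.
Qed.

Lemma local_config_meet (x y : config W) beta (alpha : {set V}) :
  local_config (cmeet x y) beta alpha =
  cmeet (local_config x beta alpha) (local_config y beta alpha).
Proof. by apply/ffunP => i; rewrite !ffunE; case: copy_at => // w; rewrite ffunE. Qed.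

Lemma local_config_join (x y : config W) beta (alpha : {set V}) :
  local_config (cjoin x y) beta alpha =
  cjoin (local_config x beta alpha) (local_config y beta alpha).
Proof. by apply/ffunP => i; rewrite !ffunE; case: copy_at => // w; rewrite ffunE. Qed.

Lemma log_supermodular_cover_function : log_supermodular g.
Proof.
apply: log_supermodularM.
- by move=> y; apply: prodr_ge0 => i _; apply: prodr_ge0.
- by move=> y; apply: prodr_ge0 => i _; apply: prodr_ge0 => b _; exact/psi0/valP.
- apply: log_supermodular_prod => i _; first by move=> y; apply: prodr_ge0.
  by apply: log_supermodular_prod => // w _; exact: log_supermodular_eval.
apply: log_supermodular_prod => alpha _.
  by move=> y; apply: prodr_ge0 => b _; exact/psi0/valP.
apply: log_supermodular_prod => beta _; first by move=> y; exact/psi0/valP.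
move=> x y; rewrite local_config_meet local_config_join.
exact/psi_lsm/valP.
Qed.

Lemma card_var_fiber i : #|[set w : W | h (val w) == inl i]| = k.
Proof.
rewrite -(card_imset _ val_inj) -(h_kcover.2 (inl i)); apply: eq_card => u.
rewrite inE; apply/imsetP/idP => [[w]|hu]; first by rewrite inE => hw ->.
have vu : is_var (h u) by rewrite (eqP hu).
by exists (exist _ u vu : W); rewrite ?inE.
Qed.

(* copy_at _ i is injective on the k copies of alpha since each copy of i is
   adjacent to only one of them, hence it is a bijection onto the k copies of i. *)
Lemma card_local_config (y : config W) (alpha : {alpha : {set V} | alpha \in A})
    (i : {i : V | i \in val alpha}) :
  #|[set beta | (h beta == inr alpha) && local_config y beta (val alpha) i]| =
  #|[set w : W | (h (val w) == inl (val i)) && y w]|.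
Proof.
have [cov fib] := h_kcover; have [_ inj _] := cov.
pose S := [set beta | h beta == inr alpha].
pose T := [set w : W | h (val w) == inl (val i)].
have copyP beta : beta \in S -> exists w : W, [/\ copy_at h beta (val i) = Some w,
    adj beta (val w) & h (val w) = inl (val i)].
  by rewrite inE => /eqP hb; apply: (copy_atP cov hb (valP i)).
have copy_inj : {in S &, injective (fun beta => copy_at h beta (val i))}.
  move=> b b' bS b'S; have [w [-> bw hw]] := copyP b bS.
  have [w' [-> b'w' hw']] := copyP b' b'S; case=> ww'; rewrite -ww' in b'w'.
  apply: (inj (val w)); rewrite ?inE 1?adj_sym //.
  by move: bS b'S; rewrite !inE => /eqP -> /eqP ->.
have SomeI : injective (@Some W) by move=> ? ? [].
have img : (fun beta => copy_at h beta (val i)) @: S = Some @: T.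
  apply/eqP; rewrite eqEcard; apply/andP; split.
    apply/subsetP => _ /imsetP[b bS ->]; have [w [-> _ hw]] := copyP b bS.
    by apply/imsetP; exists w; rewrite ?inE ?hw.
  by rewrite (card_imset _ SomeI) card_in_imset // fib card_var_fiber.
rewrite -(card_imset _ SomeI).
rewrite -(card_in_imset (f := fun beta => copy_at h beta (val i))); last first.
  move=> b b'; rewrite !inE => /andP[bS _] /andP[b'S _].
  by apply: copy_inj; rewrite inE.
apply: eq_card => o; apply/imsetP/imsetP => [[b]|[w]].
  rewrite inE => /andP[bS]; rewrite ffunE.
  have [|w [-> _ hw]] := copyP b; first by rewrite inE.
  by move=> yw ->; exists w; rewrite // inE hw eqxx.
rewrite inE => /andP[wT yw] ->.
have /imsetP[b bS bw] : Some w \in (fun beta => copy_at h beta (val i)) @: S.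
  by rewrite img; apply: imset_f; rewrite inE.
by exists b; rewrite // inE ffunE -bw yw andbT; move: bS; rewrite inE.
Qed.

(** The one-variable factors agree on both sides. For each [alpha], the local configurations at its
    k copies are sorted by [prod_le_order_stat]. *)
Lemma cover_function_le (pi : W -> V) (y : config W) :
  (forall w, h (val w) = inl (pi w)) ->
  g y <= \prod_(j < k)
    (\prod_i phi i (fiber_stat pi y j i) *
     \prod_(alpha in A) psi (subconfig alpha (fiber_stat pi y j))).
Proof.
move=> hpi; have piE w i : (h (val w) == inl i) = (pi w == i).
  by rewrite hpi; apply/eqP/eqP => [[]|->].
have fib i : #|[set w | pi w == i]| = k.
  by rewrite -(card_var_fiber i); apply: eq_card => w; rewrite !inE piE.
rewrite big_split; apply: ler_pM.
- by apply: prodr_ge0 => i _; apply: prodr_ge0.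
- by apply: prodr_ge0 => i _; apply: prodr_ge0 => b _; exact/psi0/valP.
- rewrite exchange_big le_eqVlt; apply/orP; left; apply/eqP/eq_bigr => i _.
  by rewrite -(prod_fiber_bits _ _ (fib i)); apply: eq_bigl => w; rewrite piE.
rewrite exchange_big /= [leRHS]big_sub.
apply: ler_prod => alpha _; apply/andP; split.
  by apply: prodr_ge0 => b _; exact/psi0/valP.
pose X := [seq local_config y beta (val alpha) |
             beta <- enum [set beta | h beta == inr alpha]].
have sizeX : size X = k by rewrite size_map -cardE h_kcover.2.
have := prod_le_order_stat X (psi0 (valP alpha)) (psi_lsm (valP alpha)).
rewrite sizeX big_map big_enum_cond /=.
under eq_bigl do rewrite inE.
(* By [card_local_config], sorting over the copies of [alpha] and sorting over the copies of each
   [i] in [alpha] yield the same bits. *)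
have -> : \prod_(j < k) psi (order_stat X j) =
  \prod_(j < k) psi (subconfig (val alpha) (fiber_stat pi y j)); last first.
  by under eq_bigl do rewrite andbT.
apply: eq_bigr => j _; congr (psi _); apply/ffunP => i.
rewrite !ffunE count_map -sum1_count big_enum_cond /=; congr (_ < _)%N.
under eq_bigl do rewrite inE.
rewrite sum1dep_card card_local_config; apply: eq_card => w.
by rewrite !inE piE.
Qed.
End Cover.

Theorem theorem6 (R : realType) (V : finType) (A : {set {set V}})
    (phi : V -> bool -> R)
    (psi : forall alpha : {set V}, config {i : V | i \in alpha} -> R)
    (fG : config V -> R)
    (fG_fact : log_supermodular_factorization A phi psi fG)
    (k : nat) (k_ge1 : (1 <= k)%N)
    (H : graph) (h : H -> factor_graph A) (h_kcover : kcover k h) :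
  partition_function (cover_function phi psi (h := h)) <=
    partition_function fG ^+ k.
Proof.
have [[phi0 psi0 fE] psi_lsm] := fG_fact.
have ex (w : var_node h) : exists i, h (val w) == inl i.
  by case: w => u /=; case: (h u) => // i _; exists i.
(* The covering map on variable nodes, with values in [V] itself. *)
pose pi w := xchoose (ex w).
have hpi w : h (val w) = inl (pi w) by apply/eqP/(xchooseP (ex w)).
apply: (@partition_function_fiber_le _ _ _ pi) => //.
- move=> i; rewrite -(card_var_fiber h_kcover i); apply: eq_card => w.
  by rewrite !inE hpi; apply/eqP/eqP => [->|[]].
- exact: cover_function_ge0.
- exact: log_supermodular_cover_function.
- move=> x; rewrite fE; apply: mulr_ge0; apply: prodr_ge0 => //.
  by move=> alpha alphaA; apply: psi0.
move=> y; under eq_bigr do rewrite fE.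
exact: cover_function_le.
Qed.
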